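(* Let $k\geq 0$ and $d\geq 1$ be integers. For every graph $G$ with pathwidth $k$ and maximum degree $d$, there is a tree $T$ with $\mathrm{pw}(T)\leq 2k+1$ and a $T$-partition of $G$ with width at most $4d(k+1)^2$.
   Context: Graphs are finite, simple and undirected. For a path $P$, a path-decomposition (or $P$-decomposition) of a graph $G$ is a collection $(B_x\subseteq V(G):x\in V(P))$ of subsets of $V(G)$ (called bags) indexed by the nodes of $P$ such that (a) for every edge $uv\in E(G)$ some bag contains both $u$ and $v$, and (b) for every vertex $v\in V(G)$ the set $\{x\in V(P):v\in B_x\}$ induces a non-empty connected subpath of $P$. Its width is the maximum size of a bag, minus $1$. The pathwidth $\mathrm{pw}(G)$ is the minimum width of a path-decomposition of $G$ (over all paths $P$). For a non-empty tree $T$, a $T$-partition of a graph $G$ is a partition $(B_x:x\in V(T))$ of $V(G)$ indexed by $V(T)$ (pairwise disjoint sets with union $V(G)$) such that for every edge $vw\in E(G)$, if $v\in B_x$ and $w\in B_y$, then $x=y$ or $xy\in E(T)$. The width of a $T$-partition is $\max\{|B_x|:x\in V(T)\}$. *)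

(* Defs.v *)
From HB Require Import structures.
From mathcomp Require Import all_boot all_order all_algebra.
From mathcomp Require Import boolp.

Set Implicit Arguments.
Unset Strict Implicit.
Unset Printing Implicit Defensive.

Import Order.TTheory GRing.Theory Num.Theory.

Record sgraph := SGraph {
  vertex :> finType;
  adj : rel vertex;
  adj_sym : symmetric adj;
  adj_irr : irreflexive adj }.

Definition degree (G : sgraph) (v : G) : nat := #|[set w | adj v w]|.

Definition max_degree (G : sgraph) : nat := \max_(v : G) degree v.

(* The subgraph of [G] induced by [A] is connected. It is vacuously so when
   [A] is empty; non-emptiness is always required separately below. *)
Definition induces_connected (G : sgraph) (A : {set G}) : Prop :=
  forall x y, x \in A -> y \in A ->
    connect [rel u v : G | [&& u \in A, v \in A & adj u v]] x y.

Definition acyclic (G : sgraph) : Prop :=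
  forall c : seq G, 2 < size c -> ~ ucycle (@adj G) c.

Definition is_tree (G : sgraph) : Prop :=
  [/\ 0 < #|G|, induces_connected [set: G] & acyclic G].

(* The path with [n.+1] nodes, so that a path has at least one node. *)
Definition path_adj (n : nat) : rel 'I_n.+1 :=
  [rel i j : 'I_n.+1 | (i.+1 == j :> nat) || (j.+1 == i :> nat)].

Lemma path_adj_sym n : symmetric (@path_adj n).
Proof. by move=> i j; rewrite /path_adj /= orbC. Qed.

Lemma path_adj_irr n : irreflexive (@path_adj n).
Proof. by move=> i; rewrite /path_adj /= orbb gtn_eqF. Qed.

Definition path_graph (n : nat) : sgraph :=
  SGraph (@path_adj_sym n) (@path_adj_irr n).

Record path_decomposition (G : sgraph) (n : nat)
    (B : path_graph n -> {set G}) : Prop := PathDecomposition {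
  pd_edge : forall u v : G, adj u v -> exists x, (u \in B x) && (v \in B x);
  pd_nonempty : forall v : G, [set x | v \in B x] != set0;
  pd_connected : forall v : G, induces_connected [set x | v \in B x] }.

Definition max_bag (I G : finType) (B : I -> {set G}) : nat :=
  \max_(x : I) #|B x|.

(* Integer-valued: the graph without vertices has a decomposition of width -1. *)
Definition pd_width (G : sgraph) (n : nat) (B : path_graph n -> {set G}) : int :=
  ((max_bag B)%:Z - 1)%R.

Lemma trivial_path_decomposition (G : sgraph) :
  path_decomposition (fun _ : path_graph 0 => [set: G]).
Proof.
split=> [u v _|v|v x y _ _].
- by exists ord0; rewrite !inE.
- by apply/set0Pn; exists ord0; rewrite !inE.
- by rewrite (ord1 x) (ord1 y) connect0.
Qed.

Definition pd_size (G : sgraph) (s : nat) : Prop :=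
  exists n, exists2 B : path_graph n -> {set G},
    path_decomposition B & max_bag B = s.

Lemma pd_size_exists (G : sgraph) : exists s, `[< pd_size G s >].
Proof.
exists (max_bag (fun _ : path_graph 0 => [set: G])).
by apply/asboolP; exists 0; exists (fun=> [set: G]) => //;
  exact: trivial_path_decomposition.
Qed.

(* Minimising the width amounts to minimising the largest bag size; see
   [pathwidth_attained] and [pathwidth_le]. *)
Definition pathwidth (G : sgraph) : int :=
  ((ex_minn (pd_size_exists G))%:Z - 1)%R.

Lemma pathwidth_attained (G : sgraph) :
  exists n, exists2 B : path_graph n -> {set G},
    path_decomposition B & pd_width B = pathwidth G.
Proof.
rewrite /pathwidth; case: ex_minnP => s /asboolP[n [B pdB <-]] _.
by exists n, B.
Qed.

Lemma pathwidth_le (G : sgraph) (n : nat) (B : path_graph n -> {set G}) :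
  path_decomposition B -> (pathwidth G <= pd_width B)%R.
Proof.
move=> pdB; rewrite /pathwidth; case: ex_minnP => s _ min_s.
rewrite lerD2r lez_nat; apply: min_s.
by apply/asboolP; exists n, B.
Qed.

Record graph_partition (T G : sgraph) (B : T -> {set G}) : Prop :=
  GraphPartition {
  gp_disjoint : forall x y : T, x != y -> [disjoint B x & B y];
  gp_cover : \bigcup_(x : T) B x = [set: G];
  gp_edge : forall (v w : G) (x y : T), adj v w -> v \in B x -> w \in B y ->
    (x == y) || adj x y }.

Definition partition_width (T G : sgraph) (B : T -> {set G}) : nat :=
  max_bag B.

(* Main.v *)
Require Import Defs.
From mathcomp Require Import all_boot all_order all_algebra.
From mathcomp Require Import boolp zify.

Set Implicit Arguments.
Unset Strict Implicit.
Unset Printing Implicit Defensive.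

(* Pad the path-decomposition with an empty bag at each end. A segment is a
   pair a < b of positions; its inner vertices are those all of whose bags lie
   strictly between a and b. For every inner vertex s with a neighbour v in the
   bag of a or of b, choose a position whose bag contains both s and v; these
   positions together with a + 1 are the cuts of the segment. The part of the
   segment consists of its inner vertices lying in the bag of some cut. There
   are at most 2d(k+1) + 1 cuts, so that the part has at most
   (2d(k+1) + 1)(k+1) <= 4d(k+1)^2 vertices. Recursing in the segments between
   consecutive cuts gives a tree-partition of G: every inner vertex with a
   neighbour that is not inner lies in the part.

   Call a vertex live in a segment if it is an inner vertex or has an inner
   neighbour, and let the weight of a segment be the largest number of live
   vertices in a bag strictly between its ends. If a cut comes from a vertex v in
   the bag of a, then v lies in every bag between a and the cut and is not
   live in the subsegments there, which thus have smaller weight; likewise for b.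
   Hence at most one subsegment keeps the weight, and by induction on the weight
   the tree has pathwidth at most the weight of its root, so at most
   k + 1 <= 2k + 1. *)


(** * Path-decompositions as sequences of bags *)

Section Block.
Variable T : finType.
Implicit Types (z : T) (B : {set T}) (L : seq {set T}).

(** Condition (b) of a path-decomposition for [z], in a form that survives concatenation of lists of
    bags. *)
Definition block z L := exists L1 L2 L3, [/\ L = L1 ++ L2 ++ L3, L2 != [::],
  {in L1, forall B, z \notin B}, {in L2, forall B, z \in B}
  & {in L3, forall B, z \notin B}].

Lemma block_catl z L L' :
  block z L -> {in L', forall B, z \notin B} -> block z (L ++ L').
Proof.
move=> [L1 [L2 [L3 [-> nz h1 h2 h3]]]] h'; exists L1, L2, (L3 ++ L').
split=> //; first by rewrite -!catA.
by move=> B; rewrite mem_cat => /orP[/h3|/h'].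
Qed.

Lemma block_catr z L L' :
  {in L, forall B, z \notin B} -> block z L' -> block z (L ++ L').
Proof.
move=> h [L1 [L2 [L3 [-> nz h1 h2 h3]]]]; exists (L ++ L1), L2, L3.
split=> //; first by rewrite -!catA.
by move=> B; rewrite mem_cat => /orP[/h|/h1].
Qed.

Lemma block_cons z B L :
  block z L -> (z \in B -> z \in head set0 L) -> block z (B :: L).
Proof.
move=> bL; have [zB /(_ isT)|zB _] := boolP (z \in B); last first.
  by apply: (@block_catr _ [:: B]) => // B'; rewrite inE => /eqP->.
case: bL => -[|B1 L1] [L2 [L3 [-> nz h1 h2 h3]]] /=.
  move=> _; exists [::], (B :: L2), L3; split=> // B'.
  by rewrite inE => /orP[/eqP->|/h2].
by move=> zB1; have := h1 B1; rewrite inE eqxx zB1 => /(_ isT).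
Qed.

Lemma block_all z L : L != [::] -> {in L, forall B, z \in B} -> block z L.
Proof. by exists [::], L, [::]; rewrite cats0; split. Qed.

Lemma block_flatten (I : eqType) (F : I -> seq {set T}) (s : seq I) i z :
  uniq s -> i \in s -> block z (F i) ->
  (forall j, j \in s -> j != i -> {in F j, forall B, z \notin B}) ->
  block z (flatten [seq F j | j <- s]).
Proof.
elim: s => //= j s IHs /andP[js us]; rewrite inE => /orP[/eqP ->|i_s] bz h.
  apply: block_catl => // B /flattenP[L /mapP[l ls ->]]; apply: h.
    by rewrite inE ls orbT.
  by apply: contraNneq js => <-.
apply: block_catr.
  by apply: h; rewrite ?inE ?eqxx //; apply: contraNneq js => ->.
by apply: IHs => // l ls; apply: h; rewrite inE ls orbT.
Qed.

Lemma block_map z L (f : {set T} -> {set T}) :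
  (forall B, (z \in f B) = (z \in B)) -> block z L -> block z (map f L).
Proof.
move=> fE [L1 [L2 [L3 [-> nz h1 h2 h3]]]].
exists (map f L1), (map f L2), (map f L3); split.
- by rewrite !map_cat.
- by case: L2 nz {h2}.
- by move=> B /mapP[B' /h1 h ->]; rewrite fE.
- by move=> B /mapP[B' /h2 h ->]; rewrite fE.
- by move=> B /mapP[B' /h3 h ->]; rewrite fE.
Qed.

Lemma block_mem z L : block z L -> exists2 i, i < size L & z \in nth set0 L i.
Proof.
move=> [L1 [[|B L2] [L3 [-> // _ _ h2 _]]]]; exists (size L1).
  by rewrite !size_cat /=; lia.
by rewrite nth_cat ltnn subnn /= h2 // inE eqxx.
Qed.

Lemma block_convex z L i j l : block z L -> i <= j <= l -> l < size L ->
  z \in nth set0 L i -> z \in nth set0 L l -> z \in nth set0 L j.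
Proof.
move=> [L1 [L2 [L3 [-> _ h1 h2 h3]]]] /andP[ij jl].
rewrite !size_cat => lL; rewrite !nth_cat.
case: (ltnP i (size L1)) => i1; first by rewrite (negPf (h1 _ (mem_nth _ _))).
rewrite !ltnNge (leq_trans i1 ij) (leq_trans i1 (leq_trans ij jl)) /=.
move=> _; case: (leqP (size L2)) => l2 zl.
  have l3 : l - size L1 - size L2 < size L3 by lia.
  by move: zl; rewrite (negPf (h3 _ (mem_nth _ l3))).
have j2 := leq_ltn_trans (leq_sub2r _ jl) l2.
by rewrite leqNgt j2 h2 ?mem_nth.
Qed.

End Block.

Lemma path_graph_convex n (A : {set path_graph n}) :
  (forall i j l : path_graph n, i <= j <= l -> i \in A -> l \in A -> j \in A) ->
  induces_connected A.
Proof.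
move=> cA.
rewrite /induces_connected; set e := (X in connect X).
have e_sym : connect_sym e.
  apply: sym_connect_sym => i j.
  by rewrite /e /= andbCA /path_adj /= orbC.
have main (d : nat) (x y : path_graph n) :
    y = x + d :> nat -> x \in A -> y \in A -> connect e x y.
  elim: d x y => [|d IHd] x y yE xA yA.
    by have -> : x = y by apply/ord_inj; lia.
  have zn : x + d < n.+1 by have := ltn_ord y; lia.
  pose z : path_graph n := Ordinal zn.
  have zA : z \in A by apply: (cA x z y) => //=; lia.
  apply: connect_trans (IHd x z _ xA zA) (connect1 _) => //.
  by rewrite /e /= zA yA /path_adj /=; lia.
move=> x y xA yA; have [xy|yx] := leqP x y.
  by apply: (main (y - x)) => //; lia.
by rewrite e_sym; apply: (main (x - y)) => //; lia.
Qed.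

(** A walk in the path moves by one position at a time, so it cannot jump over [j]. *)
Lemma convex_path_graph n (A : {set path_graph n}) (i j l : path_graph n) :
  induces_connected A -> i <= j <= l -> i \in A -> l \in A -> j \in A.
Proof.
move=> cA /andP[ij jl] iA lA; apply: contraT => jA.
have /connectP[p] := cA _ _ iA lA.
have {jl} : l > j.
  by rewrite ltn_neqAle jl andbT; apply: contraNneq jA => /ord_inj->.
have {ij} : i < j.
  by rewrite ltn_neqAle ij andbT; apply: contraNneq jA => /ord_inj<-.
elim: p i {iA} => [|x p IHp] i /= ij jl;
  first by move=> _ lE; move: jl; rewrite lE; lia.
move=> /andP[/and3P[iA xA ix] px] lE; apply: (IHp x) => //.
have : x != j :> nat by apply: contraNneq jA => /ord_inj<-.
by move: ix; rewrite /path_adj /=; lia.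
Qed.

Lemma pathwidth_block (H : sgraph) (s : nat) (L : seq {set H}) :
  L != [::] ->
  (forall B, B \in L -> #|B| <= s.+1) -> (forall z, block z L) ->
  (forall y z : H, adj y z -> exists2 B, B \in L & (y \in B) && (z \in B)) ->
  (pathwidth H <= s%:Z)%R.
Proof.
move=> L0 cL bL eL.
have [n nE] : exists n, size L = n.+1
  by case: L L0 {cL bL eL} => // ? l; exists (size l).
pose B (i : path_graph n) := nth set0 L i.
have pdB : path_decomposition B.
  split.
  - move=> u v /eL[B' /(nthP set0)[i iL <-] uv].
    by rewrite nE in iL; exists (Ordinal iL).
  - move=> v; have [i iL vi] := block_mem (bL v); rewrite nE in iL.
    by apply/set0Pn; exists (Ordinal iL); rewrite inE.
  - move=> v; apply: path_graph_convex => i j l ijl; rewrite !inE => vi vl.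
    by apply: block_convex (bL v) ijl _ vi vl; rewrite nE; exact: ltn_ord.
apply: Order.POrderTheory.le_trans (pathwidth_le pdB) _.
rewrite /pd_width.
have : max_bag B <= s.+1.
  by apply/bigmax_leqP => i _; apply/cL/mem_nth; rewrite nE; exact: ltn_ord.
lia.
Qed.

(** * Rooted trees with weighted nodes *)

Section RootedTree.
Variables (T : finType) (child : rel T) (m : T -> nat).
Hypothesis child_lt : forall x y, child x y -> m y < m x.
Hypothesis parent_unique : forall x y z, child x z -> child y z -> x = y.

Definition tree_adj : rel T := [rel x y | child x y || child y x].

Lemma tree_adj_sym : symmetric tree_adj.
Proof. by move=> x y; rewrite /tree_adj /= orbC. Qed.

Lemma tree_adj_irr : irreflexive tree_adj.
Proof.
by move=> x; apply/negP; rewrite /tree_adj /= orbb => /child_lt; rewrite ltnn.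
Qed.

Definition rooted_tree : sgraph := SGraph tree_adj_sym tree_adj_irr.

Lemma connect_le x y : connect child x y -> m y <= m x.
Proof.
move=> /connectP[p + ->]; elim: p x => //= z p IHp x /andP[/child_lt xz /IHp].
by move/leq_trans; apply; exact: ltnW.
Qed.

Lemma connect_child x y :
  connect child x y -> x = y \/ exists2 z, child x z & connect child z y.
Proof.
move=> /connectP[[|z p] /= + ->]; first by left.
by move=> /andP[xz pz]; right; exists z => //; apply/connectP; exists p.
Qed.

(** Since parents are unique, two downward paths with the same last node can be shortened together
    from that end until one of them is empty. *)
Lemma ancestors_chain x y z : connect child x z -> connect child y z ->
  connect child x y \/ connect child y x.
Proof.
move=> /connectP[p + ->].
elim/last_ind: p => [|p t IHp] /= in z *; first by right.
rewrite rcons_path last_rcons => /andP[xp pt].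
move=> /connectP[q]; elim/last_ind: q => [|q u _] /=.
  move=> _ <-; left; apply/connectP; exists (rcons p t); rewrite ?last_rcons //.
  by rewrite rcons_path xp.
rewrite rcons_path last_rcons => /andP[yq qu] tu.
rewrite -tu in qu; have E := parent_unique pt qu.
by apply: (IHp (last x p)) => //; rewrite E; apply/connectP; exists q.
Qed.

(** Otherwise one of [x], [y] is a proper descendant of the other. Its parent is [v], so the other
    sibling is an ancestor of [v], although its measure is below that of [v]. *)
Lemma siblings_disjoint v x y z : child v x -> child v y ->
  connect child x z -> connect child y z -> x = y.
Proof.
have sub x' y' : child v x' -> child v y' -> connect child x' y' -> x' = y'.
  move=> vx vy /connectP[p]; elim/last_ind: p => [//|p t _] /=.
  rewrite rcons_path last_rcons => /andP[xp pt] yE; rewrite -yE in pt.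
  have vE := parent_unique vy pt.
  have : connect child x' v by rewrite vE; apply/connectP; exists p.
  by move=> /connect_le; have := child_lt vx; lia.
move=> vx vy xz yz; have [xy|yx] := ancestors_chain xz yz; first exact: sub.
by apply/esym/sub.
Qed.

Lemma rooted_is_tree (r : T) :
  (forall x, connect child r x) -> is_tree rooted_tree.
Proof.
move=> rT; split.
- by apply/card_gt0P; exists r.
- rewrite /induces_connected; set e := (X in connect X).
  have e_sym : connect_sym e.
    by apply: sym_connect_sym => x y; rewrite /e /= !inE /tree_adj /= orbC.
  have re x : connect e r x.
    apply: (connect_sub _ (rT x)) => {}x y xy; apply: connect1.
    by rewrite /e /= !inE /tree_adj /= xy.
  by move=> x y _ _; apply: connect_trans (re y); rewrite e_sym.
- move=> c c2 /andP[cyc uc].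
  have [x0 x0c] : exists x0, x0 \in c
    by case: c c2 {cyc uc} => // x0 s *; exists x0; exact: mem_head.
  (* Both neighbours in the cycle of a node of minimal measure are its parent. *)
  case: (arg_minnP m x0c) => x xc xmin.
  have [i p cE] := rot_to xc.
  have {}cyc : cycle (@adj rooted_tree) (x :: p) by rewrite -cE rot_cycle.
  have {}uc : uniq (x :: p) by rewrite -cE rot_uniq.
  have {}c2 : 2 < size (x :: p) by rewrite -cE size_rot.
  have {}xmin y : y \in x :: p -> m x <= m y by rewrite -cE mem_rot; exact: xmin.
  case: p => [|y [|z p]] // in cyc uc c2 xmin {cE}.
  have par t : t \in [:: x, y, z & p] -> tree_adj x t -> child t x.
    by move=> /xmin tx /orP[/child_lt|//]; lia.
  move: cyc; rewrite (cycle_path x) /=.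
  case/and3P=> lx xy _; have lc : last z p \in [:: x, y, z & p].
    by rewrite 2!inE mem_last !orbT.
  have yx : child y x by apply: par; rewrite // !inE eqxx orbT.
  have {}lx : child (last z p) x by apply: par; rewrite // tree_adj_sym.
  move: uc; rewrite (parent_unique yx lx) /=.
  by rewrite mem_last andbF.
Qed.

Variable w : T -> nat.
Hypothesis w_gt0 : forall x, 0 < w x.
Hypothesis w_child : forall x y, child x y -> w y <= w x.
Hypothesis w_heavy : forall x y z,
  child x y -> child x z -> w y = w x -> w z = w x -> y = z.

(** A path-decomposition of the subtree at [v] of width at most [w v]. Having [v] in its first bag
    allows a bag with [v] and its parent to be put in front. *)
Definition layout v (L : seq {set T}) :=
  [/\ forall B, B \in L -> #|B| <= (w v).+1,
      forall B z, B \in L -> z \in B -> connect child v z,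
      forall z, connect child v z -> block z L,
      forall y z, connect child v y -> child y z ->
        exists2 B, B \in L & (y \in B) && (z \in B)
    & v \in head set0 L].

(* A layout of [v] consists of the layouts of the children lighter than [v],
   with [v] added to every bag, then the bag [set v; u] and the layout of [u],
   where [u] is the child as heavy as [v]. *)
Lemma layout_exists v : exists L, layout v L.
Proof.
have [n] := ubnP (m v); elim: n v => // n IHn v vn.
have /choice[F FP] c : exists L, child v c -> layout c L.
  have [vc|] := boolP (child v c); last by exists [::].
  by have [|L ?] := IHn c; [have := child_lt vc; lia|exists L].
have notv c : child v c -> connect child c v = false.
  by move=> vc; apply/negP => /connect_le; have := child_lt vc; lia.
pose low := [seq c <- enum T | child v c && (w c < w v)].
have lowP c : (c \in low) = child v c && (w c < w v).
  by rewrite mem_filter mem_enum andbT.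
pose A := flatten [seq [seq v |: B | B <- F c] | c <- low].
have AP B : B \in A -> exists c B',
    [/\ child v c, w c < w v, B' \in F c & B = v |: B'].
  move=> /flattenP[_ /mapP[c + ->] /mapP[B' B'F ->]].
  by rewrite lowP => /andP[vc cv]; exists c, B'.
have AI c B : child v c -> w c < w v -> B \in F c -> v |: B \in A.
  move=> vc cv BF; apply/flattenP; exists [seq v |: B | B <- F c].
    by apply: map_f; rewrite lowP vc.
  exact: map_f.
have ABL c z : child v c -> w c < w v -> connect child c z -> block z A.
  move=> vc cv cz; have zv : z != v by apply: contraTneq cz => ->; rewrite notv.
  apply: (@block_flatten _ _ (fun c => [seq v |: B | B <- F c]) _ c).
  - by rewrite filter_uniq // enum_uniq.
  - by rewrite lowP vc.
  - apply: block_map => [B|]; first by rewrite !inE (negPf zv).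
    by have [_ _ + _ _] := FP c vc; apply.
  - move=> j; rewrite lowP => /andP[vj _] jc _ /mapP[B BF ->].
    rewrite !inE (negPf zv) /=; apply: contra jc => zB; apply/eqP.
    have [_ /(_ _ _ BF zB) jz _ _ _] := FP j vj.
    exact: siblings_disjoint vj vc jz cz.
(* If there is a child [u] as heavy as [v], then [M] is [[set v; u]] and [L] the layout of [u];
   otherwise [M] is [[set v]] and [L] is empty. *)
have [M [L [vM [ML Ld Mu [Lb Le]]]]] :
   exists (M : {set T}) (L : seq {set T}), v \in M /\
   [/\ forall B, B \in M :: L -> #|B| <= (w v).+1,
       forall B z, B \in L -> z \in B ->
         exists c, [/\ child v c, w c = w v & connect child c z],
       forall z, z \in M -> z = v \/ child v z /\ w z = w v
     & (forall c z, child v c -> w c = w v -> connect child c z ->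
          block z (M :: L)) /\
       (forall c, child v c -> w c = w v -> c \in M /\
          forall y z, connect child c y -> child y z ->
            exists2 B, B \in L & (y \in B) && (z \in B))].
  case: (pickP (fun c => child v c && (w c == w v))) => [u /andP[vu /eqP uw]|none].
    have [c1 c2 c3 c4 c5] := FP u vu.
    exists [set v; u], (F u); split; first by rewrite !inE eqxx.
    split.
    - move=> B; rewrite inE => /orP[/eqP->|/c1]; last by rewrite uw.
      (* Positive weight leaves room for a bag of two nodes. *)
      by have := w_gt0 v; rewrite cards2; lia.
    - by move=> B z /c2 h /h uz; exists u.
    - by move=> z; rewrite !inE => /orP[/eqP->|/eqP->]; [left|right].
    - split=> [c z vc cw|c vc cw]; rewrite (w_heavy vc vu cw uw).
        move=> uz; apply: block_cons; first exact: c3.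
        rewrite !inE => /orP[/eqP zv|/eqP->//].
        by move: uz; rewrite zv notv.
      by rewrite !inE eqxx orbT; split.
  exists [set v], [::]; rewrite inE; split=> //; split=> //.
  - by move=> B; rewrite inE => /eqP->; rewrite cards1.
  - by move=> z; rewrite inE => /eqP->; left.
  - by split=> [c z vc cw|c vc cw]; have := none c; rewrite vc cw eqxx.
exists (A ++ M :: L); split.
- move=> B; rewrite mem_cat => /orP[/AP[c [B' [vc cv BF ->]]]|/ML//].
  have [/(_ _ BF) + _ _ _ _] := FP c vc.
  (* The extra element [v] is paid for by [w c < w v]. *)
  by rewrite cardsU1; case: (_ \notin _); lia.
- move=> B z; rewrite mem_cat inE.
  case/or3P=> [/AP[c [B' [vc cv BF ->]]]|/eqP->/Mu[->//|[vz _]]|BL zB].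
  + rewrite !inE => /orP[/eqP->//|zB].
    have [_ /(_ _ _ BF zB) cz _ _ _] := FP c vc.
    exact: connect_trans (connect1 vc) cz.
  + exact: connect1.
  + have [c [vc _ cz]] := Ld _ _ BL zB.
    exact: connect_trans (connect1 vc) cz.
- move=> z /connect_child[<-|[c vc cz]].
    rewrite -cat1s catA; apply: block_catl.
      apply: block_all => [|B]; first by case: (A).
      rewrite mem_cat inE => /orP[/AP[c [B' [_ _ _ ->]]]|/eqP->//].
      by rewrite !inE eqxx.
    move=> B BL; apply/negP => vB; have [c [vc _]] := Ld _ _ BL vB.
    by rewrite notv.
  have zv : z != v by apply: contraTneq cz => ->; rewrite notv.
  have := w_child vc; rewrite leq_eqVlt => /orP[/eqP cw|cw].
    apply: block_catr; last exact: Lb cz.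
    move=> _ /AP[c' [B' [vc' cv' BF ->]]]; rewrite !inE (negPf zv) /=.
    apply/negP => zB; have [_ /(_ _ _ BF zB) cz' _ _ _] := FP c' vc'.
    by move: cv'; rewrite (siblings_disjoint vc' vc cz' cz) cw ltnn.
  apply: block_catl; first exact: ABL cz.
  move=> B; rewrite inE => /orP[/eqP->|BL]; apply/negP.
    move=> /Mu[/eqP|[vz zw]]; first by rewrite (negPf zv).
    by move: cw; rewrite (siblings_disjoint vc vz cz (connect0 _ _)) zw ltnn.
  move=> /(Ld _ _ BL)[c' [vc' cw' cz']].
  by move: cw; rewrite (siblings_disjoint vc vc' cz cz') cw' ltnn.
- move=> y z /connect_child[<-|[c vc cy]] yz.
    have := w_child yz; rewrite leq_eqVlt => /orP[/eqP zw|zw].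
      exists M; first by rewrite mem_cat inE eqxx orbT.
      by rewrite vM; have [] := Le z yz zw.
    have [_ _ /(_ z (connect0 _ _))/block_mem[i iF zi] _ _] := FP z yz.
    exists (v |: nth set0 (F z) i).
      by rewrite mem_cat (AI z) // mem_nth.
    by rewrite !inE eqxx zi orbT.
  have := w_child vc; rewrite leq_eqVlt => /orP[/eqP cw|cw].
    have [_ h] := Le c vc cw; have [B BL yzB] := h y z cy yz.
    by exists B; rewrite // mem_cat inE BL !orbT.
  have [_ _ _ /(_ y z cy yz)[B BF /andP[yB zB]] _] := FP c vc.
  exists (v |: B); first by rewrite mem_cat (AI c).
  by rewrite !inE yB zB !orbT.
- case EA : A => [|B A'] //=.
  have /AP[c [B' [_ _ _ ->]]] : B \in A by rewrite EA inE eqxx.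
  by rewrite !inE eqxx.
Qed.

Lemma pathwidth_rooted_tree (r : T) : (forall x, connect child r x) ->
  (pathwidth rooted_tree <= (w r)%:Z)%R.
Proof.
move=> rT; have [L [c1 _ c3 c4 c5]] := layout_exists r.
apply: (@pathwidth_block rooted_tree _ L) => //.
- by case: (L) c5; rewrite //= inE.
- by move=> z; apply: c3.
- move=> y z /orP[yz|zy]; first exact: c4.
  by have [B BL zyB] := c4 z y (rT z) zy; exists B; rewrite // andbC.
Qed.

End RootedTree.


(** * Tree-partitions from nested vertex sets *)

Section NestedSets.
(** [C x] holds the vertices still to be distributed at [x] and its descendants, [R x] those that
    form the bag of [x]. *)
Variables (G : sgraph) (X : finType) (child : rel X) (m w : X -> nat).
Variables (C R : X -> {set G}) (r : X).
Hypothesis child_lt : forall x y, child x y -> m y < m x.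
Hypothesis C_child : forall x y, child x y -> C y \subset C x :\: R x.
Hypothesis R_sub : forall x, R x \subset C x.
Hypothesis C_sep : forall x y z u v, child x y -> child x z ->
  u \in C y -> v \in C z -> u = v \/ adj u v -> y = z.
Hypothesis C_cover : forall x v, v \in C x -> v \notin R x ->
  exists2 y, child x y & v \in C y.
Hypothesis C_boundary : forall x u v,
  u \in C x -> v \notin C x -> adj u v -> u \in R x.
Hypothesis C_nonempty : forall x, connect child r x -> C x != set0.
Hypothesis C_root : C r = [set: G].
Hypothesis w_gt0 : forall x, C x != set0 -> 0 < w x.
Hypothesis w_child : forall x y, child x y -> w y <= w x.
Hypothesis w_heavy : forall x y z,
  child x y -> child x z -> w y = w x -> w z = w x -> y = z.

Let sub_child x y v : child x y -> v \in C y -> v \in C x.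
Proof. by move=> /C_child/subsetP h /h; rewrite inE => /andP[]. Qed.

Let R_child x y v : child x y -> v \in C y -> v \notin R x.
Proof. by move=> /C_child/subsetP h /h; rewrite inE => /andP[]. Qed.

Let C_mono x y v : connect child x y -> v \in C y -> v \in C x.
Proof.
move=> /connectP[p + ->]; elim: p x => //= z p IHp x /andP[xz pz] vp.
exact: sub_child xz (IHp _ pz vp).
Qed.

(** Induction along the path to [x]: if [y] is properly below the parent of [x], it is below a child
    whose set shares [v] with that of [x], and [C_sep] identifies this child with [x]. *)
Lemma nested_chain x y v : connect child r x -> connect child r y ->
  v \in C x -> v \in C y -> connect child x y \/ connect child y x.
Proof.
move=> /connectP[p + ->]; elim/last_ind: p => [|p x' IHp] /=; first by left.
rewrite rcons_path last_rcons => /andP[rp px] ry vx vy.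
have [/connect_child[E|[z xz zy]]|yx] := IHp rp ry (sub_child px vx) vy.
- by right; rewrite -E connect1.
- left; have vz := C_mono zy vy.
  by rewrite (C_sep px xz vx vz (or_introl _ erefl)).
- by right; apply: connect_trans yx (connect1 px).
Qed.

Let R_inj x y v : connect child r x -> connect child r y ->
  v \in R x -> v \in R y -> x = y.
Proof.
wlog xy : x y / connect child x y.
  move=> wl rx ry vx vy.
  have [] := nested_chain rx ry (subsetP (R_sub x) v vx) (subsetP (R_sub y) v vy).
    by move=> xy; apply: wl.
  by move=> yx; apply/esym/wl.
move=> rx ry vx vy; have [//|[z xz zy]] := connect_child xy.
have vz := C_mono zy (subsetP (R_sub y) v vy).
by have := R_child xz vz; rewrite vx.
Qed.

(** A vertex of [C z] makes [x] and [y] comparable. If [y] were properly below [x], the child of [x]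
    above [y] would be [z] by [C_sep], and [z] would be both above and below [y]. *)
Let parent_uniq x y z : connect child r x -> connect child r y ->
  child x z -> child y z -> x = y.
Proof.
move=> rx ry xz yz.
have [v vz] : exists v, v \in C z.
  by apply/set0Pn/C_nonempty; apply: connect_trans rx (connect1 xz).
wlog xy : x y rx ry xz yz / connect child x y.
  move=> wl.
  have [] := nested_chain rx ry (sub_child xz vz) (sub_child yz vz).
    by move=> xy; apply: wl.
  by move=> yx; apply/esym/wl.
have [//|[t xt ty]] := connect_child xy.
have vt := C_mono ty (sub_child yz vz).
have E := C_sep xt xz vt vz (or_introl _ erefl).
have := connect_le child_lt ty; have := child_lt yz; rewrite E; lia.
Qed.

(** Take [z] of minimal measure with [u] and [v] in [C z]. By [C_sep] they are not both outside
    [R z]; if just one is, [C_boundary] puts it in the bag of a child of [z]. *)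
Let edge u v x y : connect child r x -> connect child r y -> adj u v ->
  u \in R x -> v \in R y -> [\/ x = y, child x y | child y x].
Proof.
move=> rx ry uv ux vy.
pose P z := [&& connect child r z, u \in C z & v \in C z].
have Pr : P r by rewrite /P connect0 C_root !inE.
case: (arg_minnP m Pr) => z /and3P[rz uz vz] zmin.
have half a b c c' : connect child r c -> connect child r c' -> adj a b ->
    a \in R c -> a \in R z -> b \in C z -> b \notin R z -> b \in R c' ->
    child c c'.
  move=> rc rc' ab ac az bz bz' bc'; have zc := R_inj rz rc az ac; subst c.
  have [t zt bt] := C_cover bz bz'.
  have rt := connect_trans rz (connect1 zt).
  have /C_boundary bR : b \in C t by [].
  suff bRt : b \in R t by rewrite -(R_inj rt rc' bRt bc').
  apply: (bR a); last by rewrite adj_sym.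
  by apply: contraTN az => /(R_child zt).
have [uR|uR] := boolP (u \in R z); have [vR|vR] := boolP (v \in R z).
- by constructor 1; rewrite -(R_inj rz rx uR ux) (R_inj rz ry vR vy).
- by constructor 2; exact: (half u v x y).
- by constructor 3; apply: (half v u y x) => //; rewrite // adj_sym.
- have [s zs us] := C_cover uz uR; have [t zt vt] := C_cover vz vR.
  have E := C_sep zs zt us vt (or_intror _ uv); subst t.
  have := zmin s; rewrite /P us vt (connect_trans rz (connect1 zs)) => /(_ isT).
  by have := child_lt zs; lia.
Qed.

Lemma nested_sets_tree : exists T : sgraph,
  [/\ is_tree T, (pathwidth T <= (w r)%:Z)%R
    & exists2 B : T -> {set G}, graph_partition B
      & forall t, exists x, B t = R x].
Proof.
(* Only nodes reachable from [r] are kept: there parents are unique and the sets [R] are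
   disjoint. *)
pose T := {x : X | connect child r x}.
pose tchild : rel T := [rel x y | child (val x) (val y)].
have t_lt (x y : T) : tchild x y -> m (val y) < m (val x) by exact: child_lt.
have t_par (x y z : T) : tchild x z -> tchild y z -> x = y.
  by move=> xz yz; apply/val_inj; exact: parent_uniq (valP x) (valP y) xz yz.
pose rt : T := exist _ r (connect0 _ _).
have t_conn (x : T) : connect tchild rt x.
  case: x => x rx; have /connectP[p] := rx.
  elim/last_ind: p => [|p y IHp] /= in x rx *.
    move=> _ E; subst x.
    by rewrite (_ : exist _ _ _ = rt) ?connect0 //; apply/val_inj.
  rewrite rcons_path last_rcons => /andP[rp py] E; subst y.
  have rl : connect child r (last r p) by apply/connectP; exists p.
  exact: connect_trans (IHp _ rl rp erefl) (connect1 _).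
exists (rooted_tree t_lt); split.
- exact: rooted_is_tree t_par rt t_conn.
- apply: (@pathwidth_rooted_tree _ _ _ t_lt t_par (w \o val) _ _ _ rt) => //=.
  + by move=> x; apply/w_gt0/C_nonempty/(valP x).
  + by move=> x y; exact: w_child.
  + by move=> x y z xy xz yw zw; apply/val_inj; exact: w_heavy xy xz yw zw.
- exists (fun x : T => R (val x)) => [|x]; last by exists (val x).
  split.
  + move=> x y; apply: contraR => /pred0Pn[v /andP[/= vx vy]].
    by apply/eqP/val_inj; exact: R_inj (valP x) (valP y) vx vy.
  + apply/setP => v; rewrite inE; apply/bigcupP.
    pose P x := connect child r x && (v \in C x).
    have Pr : P r by rewrite /P connect0 C_root inE.
    (* At minimal measure [v] lies in the bag, as otherwise [C_cover] leads to a child. *)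
    case: (arg_minnP m Pr) => x /andP[rx vx] xmin.
    exists (exist _ x rx) => //=; apply: contraT => vR.
    have [y xy vy] := C_cover vx vR.
    have := xmin y; rewrite /P vy (connect_trans rx (connect1 xy)) => /(_ isT).
    by have := child_lt xy; lia.
  + move=> u v x y uv ux vy.
    have [E|xy|yx] := edge (valP x) (valP y) uv ux vy.
    * by rewrite (val_inj E) eqxx.
    * by apply/orP; right; apply/orP; left.
    * by apply/orP; right; apply/orP; right.
Qed.

End NestedSets.


Lemma card_bigcup_le (I T : finType) (A : {set I}) (F : I -> {set T}) c :
  (forall i, i \in A -> #|F i| <= c) -> #|\bigcup_(i in A) F i| <= #|A| * c.
Proof.
move=> Fc; rewrite -sum_nat_const.
elim/big_ind2: _ => [|s1 S1 s2 S2 h1 h2|i /Fc//]; first by rewrite cards0.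
exact: leq_trans (leq_card_setU _ _) (leq_add h1 h2).
Qed.

(** * Segments of a path-decomposition *)

Section Segments.
Variables (G : sgraph) (N k d : nat) (bag : nat -> {set G}).
Hypothesis bag_convex : forall (v : G) (i j l : nat), i <= j <= l ->
  v \in bag i -> v \in bag l -> v \in bag j.
Hypothesis bag_edge : forall u v : G, adj u v ->
  exists i, (u \in bag i) && (v \in bag i).
Hypothesis bag_nonempty : forall v : G, exists i, v \in bag i.
Hypothesis bag_inside : forall (v : G) i, v \in bag i -> 0 < i < N.
Hypothesis bag_card : forall i, #|bag i| <= k.+1.
Hypothesis deg_le : forall v : G, degree v <= d.

Let pos := 'I_N.+1.
Let seg := (pos * pos)%type.
Implicit Types (p q : seg) (x : pos).

Let bag_pos (v : G) i : v \in bag i -> exists x : pos, x = i :> nat.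
Proof. by move=> /bag_inside/andP[_ iN]; exists (inord i); rewrite inordK; lia. Qed.

(** Quantifying over [pos] keeps this boolean; [innerP] extends it to all naturals, since bags
    beyond [N] are empty. *)
Definition inner p : {set G} :=
  [set v | [forall x : pos, (v \in bag x) ==> (p.1 < x < p.2)]].

Lemma innerP p v :
  reflect (forall i, v \in bag i -> p.1 < i < p.2) (v \in inner p).
Proof.
rewrite inE; apply: (iffP forallP) => [h i vi|h x]; last exact/implyP/h.
by have [x E] := bag_pos vi; have := h x; rewrite E vi.
Qed.

Lemma inner_nonempty p v : v \in inner p -> exists i, v \in bag i /\ p.1 < i < p.2.
Proof.
by move=> /innerP h; have [i vi] := bag_nonempty v; exists i; split=> //; exact: h.
Qed.

Definition ends p : {set G} := bag p.1 :|: bag p.2.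

Definition touched p : {set G} := [set v in inner p | [exists u in ends p, adj u v]].

(** The default [ord0] is never taken for a touched [v]: some bag contains both ends of its edge to
    [ends p]. *)
Definition cut p (v : G) : pos :=
  odflt ord0 [pick x : pos |
    (v \in bag x) && [exists u in ends p, (u \in bag x) && adj u v]].

(** The cut [p.1.+1] makes every subsegment shorter than [p]; it is in range as soon as [p] has an
    inner vertex. *)
Definition cuts p : {set pos} := inord p.1.+1 |: [set cut p v | v in touched p].

Definition part p : {set G} := inner p :&: \bigcup_(x in cuts p) bag x.

(** Non-empty [inner q] forces [q.1 < q.2]; by the last clause these are consecutive among the ends
    and the cuts of [p]. *)
Definition subseg : rel seg := [rel p q : seg |
  [&& inner p != set0, inner q != set0,
      q.1 \in p.1 |: (p.2 |: cuts p), q.2 \in p.1 |: (p.2 |: cuts p)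
    & [forall x : pos, (x \in cuts p) ==> ~~ (q.1 < x < q.2)]]].

Definition live p (i : nat) : {set G} :=
  [set u in bag i | [exists v in inner p, (v == u) || adj u v]].

Definition live_width p := \max_(x : pos | p.1 < x < p.2) #|live p x|.

Lemma cutP p v : v \in touched p ->
  v \in bag (cut p v) /\
  exists u, [/\ u \in ends p, u \in bag (cut p v) & adj u v].
Proof.
rewrite inE => /andP[vp /existsP[u /andP[up uv]]].
rewrite /cut; case: pickP => [x /andP[vx /existsP[u' /and3P[a b c]]]|none] /=.
  by split=> //; exists u'.
have [i /andP[ui vi]] := bag_edge uv; have [x xi] := bag_pos ui.
have := none x; rewrite xi vi /= => /existsP[]; exists u.
by rewrite up ui.
Qed.

(** * Nesting, separation and covering by subsegments *)

Lemma touched_inner p v : v \in touched p -> v \in inner p.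
Proof. by rewrite inE => /andP[]. Qed.

Lemma cuts_inside p x : inner p != set0 -> x \in cuts p -> p.1 < x < p.2.
Proof.
move=> /set0Pn[v /inner_nonempty[i [_ ip]]].
rewrite !inE => /orP[/eqP->|/imsetP[s sp ->]].
  have := ltn_ord p.2; have ? : p.1.+1 < N.+1 by have := ltn_ord p.2; lia.
  by rewrite inordK //; lia.
by have [sb _] := cutP sp; move/touched_inner/innerP: sp; apply.
Qed.

Lemma subseg_bounds p q : subseg p q -> p.1 <= q.1 /\ q.2 <= p.2.
Proof.
case/and5P=> p0 /set0Pn[v /inner_nonempty[i [_ iq]]] q1 q2 _.
have [v' /inner_nonempty[j [_ jp]]] := set0Pn _ p0.
have b x : x \in p.1 |: (p.2 |: cuts p) -> p.1 <= x <= p.2.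
  rewrite in_setU1 in_setU1 => /or3P[/eqP->|/eqP->|/(cuts_inside p0)]; lia.
by have := b _ q1; have := b _ q2; lia.
Qed.

Lemma subseg_cut p q x : subseg p q -> x \in cuts p -> ~~ (q.1 < x < q.2).
Proof. by case/and5P=> _ _ _ _ /forallP/(_ x)/implyP. Qed.

(** The cut [p.1.+1] lies strictly inside [p] but not strictly inside [q]. *)
Lemma subseg_lt p q : subseg p q -> q.2 - q.1 < p.2 - p.1.
Proof.
move=> pq; have [] := subseg_bounds pq.
case/and5P: (pq) => p0 /set0Pn[v /inner_nonempty[i [_ iq]]] _ _ _.
have x0 : inord p.1.+1 \in cuts p by rewrite !inE eqxx.
by have := subseg_cut pq x0; have := cuts_inside p0 x0; lia.
Qed.

Lemma subseg_inner p q : subseg p q -> inner q \subset inner p :\: part p.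
Proof.
move=> pq; have [b1 b2] := subseg_bounds pq.
apply/subsetP => v /innerP vq; rewrite 2!inE; apply/andP; split; last first.
  by apply/innerP => i /vq; lia.
rewrite negb_and; apply/orP; right; apply/bigcupP => -[x xp /vq].
by have := subseg_cut pq xp; lia.
Qed.

Lemma part_inner p : part p \subset inner p.
Proof. exact: subsetIl. Qed.

(** No end or cut of [p] lies strictly inside a subsegment, so overlapping subsegments have the same
    ends. *)
Lemma subseg_apart p q1 q2 : subseg p q1 -> subseg p q2 -> q1 != q2 ->
  (q1.2 <= q2.1 \/ q2.2 <= q1.1).
Proof.
move=> h1 h2 ne.
have [a1 a2] := subseg_bounds h1; have [b1 b2] := subseg_bounds h2.
have endp q x : subseg p q -> x \in p.1 |: (p.2 |: cuts p) -> ~~ (q.1 < x < q.2).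
  move=> pq; have [] := subseg_bounds pq; rewrite in_setU1 in_setU1.
  by move=> ? ? /or3P[/eqP->|/eqP->|/(subseg_cut pq)//]; lia.
have /and5P[_ /set0Pn[v1 /inner_nonempty[i1 [_ ?]]] q11 q12 _] := h1.
have /and5P[_ /set0Pn[v2 /inner_nonempty[i2 [_ ?]]] q21 q22 _] := h2.
have n1 := endp _ _ h1 q21; have n2 := endp _ _ h1 q22.
have n3 := endp _ _ h2 q11; have n4 := endp _ _ h2 q12.
suff : (q1.1 != q2.1 :> nat) || (q1.2 != q2.2 :> nat) by lia.
apply: contraR ne; rewrite negb_or !negbK => /andP[/eqP/ord_inj e1 /eqP/ord_inj e2].
by apply/eqP; rewrite [q1]surjective_pairing e1 e2 -surjective_pairing.
Qed.

Lemma subseg_sep p q1 q2 u v : subseg p q1 -> subseg p q2 ->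
  u \in inner q1 -> v \in inner q2 -> u = v \/ adj u v -> q1 = q2.
Proof.
move=> h1 h2 /innerP u1 /innerP v2 uv.
have [i [ui vi]] : exists i, u \in bag i /\ v \in bag i.
  case: uv => [->|/bag_edge[i /andP[]]]; last by exists i.
  by have [i ?] := bag_nonempty v; exists i.
apply: contraTeq isT => /(subseg_apart h1 h2).
by have := u1 _ ui; have := v2 _ vi; lia.
Qed.

(** Around a position whose bag contains [v], take the nearest end or cut on each side. Their bags
    miss [v], so convexity keeps all bags of [v] between them. *)
Lemma subseg_cover p v : v \in inner p -> v \notin part p ->
  exists2 q, subseg p q & v \in inner q.
Proof.
move=> vp; rewrite inE vp /= => vK.
have p0 : inner p != set0 by apply/set0Pn; exists v.
have [i [vi ip]] := inner_nonempty vp.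
have nK x : x \in cuts p -> v \notin bag x.
  by move=> xp; apply: contra vK => vx; apply/bigcupP; exists x.
pose E := p.1 |: (p.2 |: cuts p).
pose below x := (x \in E) && (x <= i); pose above x := (x \in E) && (i <= x).
have E1 : below p.1 by rewrite /below !inE eqxx; lia.
have E2 : above p.2 by rewrite /above !inE eqxx orbT; lia.
case: (arg_maxnP (@nat_of_ord N.+1) E1) => a /andP[aE ai] amax.
case: (arg_minnP (@nat_of_ord N.+1) E2) => b /andP[bE ib] bmin.
have vE x : x \in E -> v \notin bag x.
  rewrite in_setU1 in_setU1 => /or3P[/eqP->|/eqP->|/nK//].
    by apply/negP => /(innerP _ _ vp); rewrite ltnn.
  by apply/negP => /(innerP _ _ vp); rewrite ltnn andbF.
have vq : v \in inner (a, b).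
  apply/innerP => j vj /=; rewrite !ltnNge -negb_or; apply/negP => /orP[ja|bj].
    by have := vE _ aE; rewrite (@bag_convex v j a i) // ja.
  by have := vE _ bE; rewrite (@bag_convex v i b j) // ib.
exists (a, b) => //; apply/and5P; split=> //; first by apply/set0Pn; exists v.
apply/forallP => x; apply/implyP => xp; apply/negP => /= /andP[ax xb].
have xE : x \in E by rewrite 2!in_setU1 xp !orbT.
have [xi|/ltnW ix] := leqP x i.
  by have := amax x; rewrite /below xE xi => /(_ isT); lia.
by have := bmin x; rewrite /above xE ix => /(_ isT); lia.
Qed.

(** The vertex [v] has a bag inside [p], shared with [u], and one that is not; by convexity it lies
    in an end bag. So [u] is touched and lies in the bag of its own cut. *)
Lemma inner_boundary p u v :
  u \in inner p -> v \notin inner p -> adj u v -> u \in part p.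
Proof.
move=> up vp uv; have [i /andP[ui vi]] := bag_edge uv.
have ip := innerP _ _ up _ ui.
have ve : v \in ends p.
  apply: contraR vp; rewrite inE negb_or => /andP[v1 v2].
  apply/innerP => j vj; rewrite !ltnNge -negb_or; apply/negP => /orP[jp|pj].
    by move: v1; rewrite (@bag_convex v j p.1 i) // jp; lia.
  by move: v2; rewrite (@bag_convex v i p.2 j) // pj andbT; lia.
have ut : u \in touched p.
  by rewrite inE up; apply/existsP; exists v; rewrite ve adj_sym.
rewrite inE up; apply/bigcupP; exists (cut p u).
  by rewrite in_setU1 imset_f ?orbT.
by have [] := cutP ut.
Qed.

(** Touched vertices are neighbours of the at most [2 * k.+1] vertices of [ends p]; the cut [p.1.+1]
    adds one, and each cut contributes one bag. *)
Lemma card_part p : #|part p| <= (d * (2 * k.+1)).+1 * k.+1.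
Proof.
apply: leq_trans (subset_leq_card (subsetIr _ _)) _.
apply: leq_trans (card_bigcup_le (fun x _ => bag_card x)) _.
rewrite leq_mul2r; apply/orP; right.
rewrite /cuts cardsU1; apply: (@leq_add _ _ 1); first by case: (_ \notin _).
apply: leq_trans (leq_imset_card _ _) _.
have sub : touched p \subset \bigcup_(u in ends p) [set v | adj u v].
  apply/subsetP => v; rewrite inE => /andP[_ /existsP[u /andP[up uv]]].
  by apply/bigcupP; exists u; rewrite // inE.
apply: leq_trans (subset_leq_card sub) _.
apply: leq_trans (card_bigcup_le (fun u _ => deg_le u)) _.
rewrite mulnC leq_mul2l; apply/orP; right.
apply: leq_trans (leq_card_setU _ _) _.
by rewrite mul2n -addnn leq_add.
Qed.

(** * Live vertices and the weight of a segment *)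

Lemma live_width_gt0 p : inner p != set0 -> 0 < live_width p.
Proof.
move=> /set0Pn[v vp]; have [i [vi ip]] := inner_nonempty vp.
have [x xi] := bag_pos vi; rewrite -xi in vi ip.
apply: (@leq_trans #|live p x|); last first.
  exact: (@leq_bigmax_cond _ _ (fun x : pos => #|live p x|)).
apply/card_gt0P; exists v; rewrite inE vi; apply/existsP; exists v.
by rewrite vp eqxx.
Qed.

Lemma live_width_le p : live_width p <= k.+1.
Proof.
apply/bigmax_leqP => x _; apply: leq_trans (bag_card x).
by apply/subset_leq_card/subsetP => u; rewrite inE => /andP[].
Qed.

Lemma live_sub p q i : subseg p q -> live q i \subset live p i.
Proof.
move=> /subseg_inner/subsetP qp; apply/subsetP => u.
rewrite !inE => /andP[-> /existsP[v /andP[/qp]]]; rewrite inE => /andP[_ vp] uv.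
by apply/existsP; exists v; rewrite vp.
Qed.

Lemma live_width_subseg p q : subseg p q -> live_width q <= live_width p.
Proof.
move=> pq; have [b1 b2] := subseg_bounds pq.
apply/bigmax_leqP => x xq; apply: leq_trans (subset_leq_card (live_sub x pq)) _.
by apply: (@leq_bigmax_cond _ _ (fun x : pos => #|live p x|)); lia.
Qed.

(* A boundary vertex [u] has all its neighbours inside [p] in [part p], so
   that it is no longer live in [q]. *)
Lemma live_width_lt p q u v :
  subseg p q -> u \in ends p -> v \in inner p -> adj u v ->
  (forall i, q.1 < i < q.2 -> u \in bag i) -> live_width q < live_width p.
Proof.
move=> pq up vp uv uq; have [b1 b2] := subseg_bounds pq.
have p0 : inner p != set0 by apply/set0Pn; exists v.
have unp : u \notin inner p.
  apply/innerP => h; move: up; rewrite inE => /orP[/h|/h]; lia.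
rewrite -(prednK (live_width_gt0 p0)) ltnS.
apply/bigmax_leqP => x xq.
suff : #|live q x| < live_width p by lia.
apply: (@leq_trans #|live p x|); last first.
  by apply: (@leq_bigmax_cond _ _ (fun x : pos => #|live p x|)); lia.
apply/proper_card/properP; split; first exact: live_sub.
exists u; rewrite inE uq //=; first by apply/existsP; exists v; rewrite vp uv orbT.
apply/existsP => -[t /andP[/(subsetP (subseg_inner pq))]].
rewrite inE => /andP[tp tq] /orP[/eqP tu|ut]; first by rewrite -tu tq in unp.
by move: tp; rewrite (@inner_boundary p t u) // adj_sym.
Qed.

(** Let [q1] come first. Its right end can only be the cut of a touched vertex, with a neighbour [u]
    in [ends p]. If [u] is in the bag of [p.1], it fills the bags inside [q1]; if in that of [p.2],
    those inside [q2]. That subsegment is lighter. *)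
Lemma live_width_heavy p q1 q2 : subseg p q1 -> subseg p q2 ->
  live_width q1 = live_width p -> live_width q2 = live_width p -> q1 = q2.
Proof.
wlog le12 : q1 q2 / q1.2 <= q2.1.
  move=> wl h1 h2 w1 w2; have [//|/(subseg_apart h1 h2)[le|le]] := eqVneq q1 q2.
    exact: wl.
  by apply/esym/wl.
move=> h1 h2 w1 w2; exfalso.
have [a1 a2] := subseg_bounds h1; have [b1 b2] := subseg_bounds h2.
have /and5P[_ /set0Pn[v1 v1q] _ q12 _] := h1.
have /and5P[_ /set0Pn[v2 /inner_nonempty[i2 [_ ?]]] _ _ _] := h2.
have [i1 [v1i ?]] := inner_nonempty v1q.
move: q12; rewrite !in_setU1 => /or4P[/eqP E|/eqP E|/eqP E|/imsetP[s sp E]].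
- by move: a1; rewrite -E; lia.
- by move: le12; rewrite E; lia.
- have : q1.2 = p.1.+1 :> nat.
    by rewrite E inordK //; have := ltn_ord p.2; lia.
  lia.
have [sc [u [up uc us]]] := cutP sp.
have sin := touched_inner sp.
have := up; rewrite inE => /orP[u1|u2].
  have := live_width_lt h1 up sin us; rewrite w1 ltnn.
  move=> /(_ _)/Bool.diff_false_true; apply.
  by move=> i iq; apply: (@bag_convex u p.1 i (cut p s)) => //; rewrite -E; lia.
have := live_width_lt h2 up sin us; rewrite w2 ltnn.
move=> /(_ _)/Bool.diff_false_true; apply.
by move=> i iq; apply: (@bag_convex u (cut p s) i p.2) => //; rewrite -E; lia.
Qed.

Lemma segments_tree : 0 < #|G| -> exists T : sgraph,
  [/\ is_tree T, (pathwidth T <= k.+1%:Z)%R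
    & exists2 B : T -> {set G}, graph_partition B
      & partition_width B <= (d * (2 * k.+1)).+1 * k.+1].
Proof.
(* By [bag_inside], every vertex is inner to this segment. *)
move=> G0; pose r : seg := (ord0, ord_max).
have rT : inner r = [set: G].
  by apply/setP => v; rewrite in_setT; apply/innerP => i /bag_inside.
have ne p : connect subseg r p -> inner p != set0.
  move=> /connectP[q + ->]; elim/last_ind: q => [_|q x _] /=.
    by rewrite rT -card_gt0 cardsT.
  by rewrite rcons_path last_rcons => /andP[_ /and5P[]].
have [T [tT pT [B pB BR]]] := nested_sets_tree subseg_lt subseg_inner part_inner
  subseg_sep subseg_cover inner_boundary ne rT live_width_gt0 live_width_subseg
  live_width_heavy.
exists T; split=> //.
  by apply: Order.POrderTheory.le_trans pT _; have := live_width_le r; lia.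
exists B => //; apply/bigmax_leqP => t _.
by have [p ->] := BR t; exact: card_part.
Qed.

End Segments.

Theorem theorem3 (k d : nat) (hd : 1 <= d) (G : sgraph)
  (hk : pathwidth G = (k%:Z)%R) (hmax : max_degree G = d) :
  exists T : sgraph,
    [/\ is_tree T,
        (pathwidth T <= ((2 * k + 1)%N%:Z))%R
      & exists2 B : T -> {set G},
          graph_partition B & partition_width B <= 4 * d * (k + 1) ^ 2].
Proof.
have [n [B pdB]] := pathwidth_attained G; rewrite hk /pd_width => wB.
have Bk : max_bag B = k.+1 by lia.
(* Node [x] of the path becomes position [x.+1]; position 0 and all positions from [n.+2] on get the
   empty bag. *)
pose bag i := if i is i'.+1 then
  if i' < n.+1 then B (inord i') else set0 else set0.
have bagP (v : G) i : v \in bag i ->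
    exists x : path_graph n, i = x.+1 /\ v \in B x.
  case: i => [|i] /=; first by rewrite inE.
  case: ltnP => [lt vB|_]; last by rewrite inE.
  by exists (inord i); rewrite inordK.
have bagE (x : path_graph n) : bag x.+1 = B x.
  by rewrite /bag ltn_ord inord_val.
have [|||||||T [tT pT [P pP cP]]] := @segments_tree G n.+2 k d bag.
- move=> v i j l ijl /bagP[x [xi vx]] /bagP[y [yl vy]].
  have jn : j.-1 < n.+1 by have := ltn_ord y; lia.
  have jE : j = (Ordinal jn : path_graph n).+1 by move=> /=; lia.
  rewrite jE bagE.
  have := @convex_path_graph n _ x (Ordinal jn) y (@pd_connected _ _ _ pdB v).
  by rewrite !inE; apply=> //=; lia.
- by move=> u v /(pd_edge pdB)[x uvx]; exists x.+1; rewrite bagE.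
- move=> v; have /set0Pn[x] := pd_nonempty pdB v; rewrite inE => vx.
  by exists x.+1; rewrite bagE.
- by move=> v i /bagP[x [-> _]]; have := ltn_ord x; lia.
- case=> [|i] /=; first by rewrite cards0.
  case: ifP => _; last by rewrite cards0.
  by rewrite -Bk; exact: (@leq_bigmax _ (fun x : path_graph n => #|B x|)).
- by move=> v; rewrite -hmax; exact: (@leq_bigmax _ (fun v : G => degree v)).
(* Without vertices all bags would be empty and the width -1, not [k]. *)
- rewrite lt0n; apply/negP => /eqP G0; have : max_bag B <= 0.
    by apply/bigmax_leqP => x _; rewrite -G0 max_card.
  by rewrite Bk.
exists T; split=> //; last exists P => //.
  by apply: Order.POrderTheory.le_trans pT _; lia.
(* The summand 1 is at most [2 * d * k.+1] because [1 <= d]. *)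
apply: leq_trans cP _; nia.
Qed.
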